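(* Let $X$ be a Hadamard space with linear dual space $X^{\lozenge}$, let $p\in X$, and let $h:X\times X^{\lozenge}\to[-\infty,\infty]$ be proper. Then: (i) for all $(x,x^{\lozenge}),(y,y^{\lozenge})\in X\times X^{\lozenge}$, $$h(x,x^{\lozenge})+h_p^{\lozenge}(y^{\lozenge},y)\ \ge\ \langle y^{\lozenge},\overrightarrow{px}\rangle+\langle x^{\lozenge},\overrightarrow{py}\rangle ;$$ (ii) $\tfrac12\big(h+h_p^{\lozenge}\circ r\big)\ge \pi_p$ everywhere on $X\times X^{\lozenge}$; (iii) for each $h\in\Gamma_p^{\lozenge}(X)$, $h\ge\pi_p$ everywhere on $X\times X^{\lozenge}$.
   Context: A Hadamard space is a (nonempty) complete $\mathrm{CAT}(0)$ space $(X,d)$. For $x,y\in X$ and $t\in[0,1]$, $(1-t)x\oplus ty$ denotes the point $c(t)$ of the unique constant-speed geodesic $c:[0,1]\to X$ from $x$ to $y$. Quasilinearization: for $x,y,u,v\in X$, $\langle\overrightarrow{xy},\overrightarrow{uv}\rangle:=\frac12\big(d(x,v)^2+d(y,u)^2-d(x,u)^2-d(y,v)^2\big)$. Dual spaces: for $t\in\mathbb R$, $a,b\in X$, $[t\overrightarrow{ab}]$ is the class of $(t,a,b)\in\mathbb R\times X^2$ under the relation $(t,a,b)\sim(s,c,d)$ iff $t\langle\overrightarrow{ab},\overrightarrow{xy}\rangle=s\langle\overrightarrow{cd},\overrightarrow{xy}\rangle$ for all $x,y\in X$; it is identified with the function $\overrightarrow{xy}\mapsto t\langle\overrightarrow{ab},\overrightarrow{xy}\rangle$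 on $X^2$. $X^*$ is the set of all such classes, and the linear dual $X^{\lozenge}$ is the real vector space of all finite linear combinations $\sum_i\alpha_i x_i^*$ ($\alpha_i\in\mathbb R$, $x_i^*\in X^*$), acting on $X^2$ by $\langle\sum_i\alpha_ix_i^*,\overrightarrow{xy}\rangle=\sum_i\alpha_i\langle x_i^*,\overrightarrow{xy}\rangle$ (elements with the same action are equal). $X^{\lozenge}$ carries the norm $\|x^{\lozenge}\|_{\lozenge}=\sup\Big\{\frac{|\langle x^{\lozenge},\overrightarrow{ab}\rangle-\langle x^{\lozenge},\overrightarrow{cd}\rangle|}{d(a,b)+d(c,d)}: a,b,c,d\in X,\ (a,c)\ne(b,d)\Big\}$, and $X\times X^{\lozenge}$ the product topology. For $h:X\times X^{\lozenge}\to[-\infty,\infty]$: $h$ is proper if it never takes the value $-\infty$ and $h\not\equiv\infty$; l.s.c. if its epigraph is closed; convex if $h((1-\lambda)x\oplus\lambda y,(1-\lambda)x^{\lozenge}+\lambda y^{\lozenge})\le(1-\lambda)h(x,x^{\lozenge})+\lambda h(y,y^{\lozenge})$ for all $(x,x^{\lozenge}),(y,y^{\lozenge})$ and $\lambda\in[0,1]$. $\Gamma(X\times X^{\lozenge})$ is the set of proper, l.s.c., convex $h:X\times X^{\lozenge}\to[-\infty,\infty]$. Fix $p\in X$. $\pi_p(x,x^{\lozenge}):=\langle x^{\lozenge},\overrightarrow{px}\rangle$ on $X\times X^{\lozenge}$; $r(x,x^{\lozenge}):=(x^{\lozenge},x)$. The indicator $\iota_A$ equals $0$ on $A$ and $\infty$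 off $A$. $\{h\le\pi_p\}:=\{(x,x^{\lozenge}):h(x,x^{\lozenge})\le\pi_p(x,x^{\lozenge})\}$. The $p$-Fenchel conjugate $h_p^{\lozenge}:X^{\lozenge}\times X\to[-\infty,\infty]$ is $$h_p^{\lozenge}(x^{\lozenge},x)=\sup_{(y,y^{\lozenge})\in X\times X^{\lozenge}}\{\langle x^{\lozenge},\overrightarrow{py}\rangle+\langle y^{\lozenge},\overrightarrow{px}\rangle-h(y,y^{\lozenge})\}.$$ $\Gamma_p^{\lozenge}(X):=\{h\in\Gamma(X\times X^{\lozenge}): h=(h+\iota_{\{h\le\pi_p\}})_p^{\lozenge}\circ r\text{ on }X\times X^{\lozenge}\}$. *)

(* Defs.v *)
From HB Require Import structures.
From mathcomp Require Import all_boot all_order all_algebra.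
From mathcomp Require Import all_classical all_reals all_analysis.
From mathcomp Require Import ring lra.

Set Implicit Arguments.
Unset Strict Implicit.
Unset Printing Implicit Defensive.

Import Order.TTheory GRing.Theory Num.Theory.
Import numFieldNormedType.Exports.

Local Open Scope classical_set_scope.
Local Open Scope ring_scope.

(* Constant-speed geodesics parametrized by [0, 1]; the values of [c] outside
   of [0, 1] are irrelevant. *)
Definition is_geodesic (R : realType) (X : metricType R) (x y : X)
    (c : R -> X) : Prop :=
  [/\ c 0 = x, c 1 = y &
      forall s t, 0 <= s <= 1 -> 0 <= t <= 1 ->
        mdist (c s) (c t) = `|s - t| * mdist x y].

(* The Euclidean distance of the plane: the library norm of [R * R] is the
   maximum norm. *)
Definition edist (R : realType) (a b : R * R) : R :=
  Num.sqrt ((a.1 - b.1) ^+ 2 + (a.2 - b.2) ^+ 2).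

Definition eseg (R : realType) (a b : R * R) (t : R) : R * R :=
  ((1 - t) * a.1 + t * b.1, (1 - t) * a.2 + t * b.2).

(* A geodesic triangle has vertices [v i] and sides [c i] from [v i] to
   [v (i + 1)], with [i : 'I_3] and addition modulo 3; [w] is a comparison
   triangle in the Euclidean plane. *)
HB.mixin Record Metric_isCAT0 (R : realType) X & Metric R X := {
  geodesic_exists : forall x y : X, exists c : R -> X, is_geodesic x y c ;
  cat0_comparison : forall (v : 'I_3 -> X) (c : 'I_3 -> R -> X)
      (w : 'I_3 -> R * R),
    (forall i, is_geodesic (v i) (v (i + 1)) (c i)) ->
    (forall i, edist (w i) (w (i + 1)) = mdist (v i) (v (i + 1))) ->
    forall i j s t, 0 <= s <= 1 -> 0 <= t <= 1 ->
      mdist (c i s) (c j t) <=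
      edist (eseg (w i) (w (i + 1)) s) (eseg (w j) (w (j + 1)) t)
}.

#[short(type="hadamardType")]
HB.structure Definition Hadamard (R : realType) :=
  { X of Metric R X & Complete X & Metric_isCAT0 R X }.

Section hadamard_geodesics.
Context {R : realType} {X : hadamardType R}.
Implicit Types x y z u v : X.

Definition geodesic x y : R -> X := projT1 (cid (geodesic_exists x y)).

(* (1 - t) x (+) t y *)
Definition oplus (t : R) x y : X := geodesic x y t.

Lemma geodesicP x y : is_geodesic x y (geodesic x y).
Proof. exact: projT2 (cid (geodesic_exists x y)). Qed.

Let tri (T : Type) (a b c : T) (i : 'I_3) : T :=
  if val i == 0%N then a else if val i == 1%N then b else c.

Lemma cat0_triangle x y z c1 c2 c3 (a b c : R * R) :
  is_geodesic x y c1 -> is_geodesic y z c2 -> is_geodesic z x c3 ->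
  edist a b = mdist x y -> edist b c = mdist y z -> edist c a = mdist z x ->
  forall s t, 0 <= s <= 1 -> 0 <= t <= 1 ->
    mdist (c1 s) (c2 t) <= edist (eseg a b s) (eseg b c t) /\
    mdist (c1 s) (c3 t) <= edist (eseg a b s) (eseg c a t).
Proof.
move=> g1 g2 g3 e1 e2 e3 s t s01 t01.
have G (i : 'I_3) :
    is_geodesic (tri x y z i) (tri x y z (i + 1)) (tri c1 c2 c3 i).
  by case: i => -[|[|[|//]]] i.
have E (i : 'I_3) : edist (tri a b c i) (tri a b c (i + 1)) =
    mdist (tri x y z i) (tri x y z (i + 1)).
  by case: i => -[|[|[|//]]] i.
have K := @cat0_comparison R X _ _ _ G E.
split.
- exact: (K (@Ordinal 3 0 isT) (@Ordinal 3 1 isT)).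
- exact: (K (@Ordinal 3 0 isT) (@Ordinal 3 2 isT)).
Qed.

Lemma eq_le_real (a b : R) : a = b -> a <= b.
Proof. by move->. Qed.

Lemma edistC (a b : R * R) : edist a b = edist b a.
Proof. by rewrite /edist -[a.1 - b.1]opprB -[a.2 - b.2]opprB !sqrrN. Qed.

Lemma edistxx (a : R * R) : edist a a = 0.
Proof. by rewrite /edist !subrr !expr0n addr0 sqrtr0. Qed.

Lemma is_geodesic_rev x y c :
  is_geodesic x y c -> is_geodesic y x (fun t => c (1 - t)).
Proof.
move=> [c0 c1 cd]; split; rewrite ?subr0 ?subrr//.
move=> s t s01 t01; rewrite cd; [|lra|lra].
by rewrite [mdist x y]metric_sym; congr (_ * _); rewrite distrC; congr (`|_|); ring.
Qed.

Lemma is_geodesic_cst x : is_geodesic x x (fun=> x).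
Proof. by split=> // s t _ _; rewrite mdistxx mulr0. Qed.

Lemma geodesic_unique x y c1 c2 (t : R) : is_geodesic x y c1 ->
  is_geodesic x y c2 -> 0 <= t <= 1 -> c1 t = c2 t.
Proof.
move=> g1 g2 t01; apply: mdist_positivity; apply/eqP.
rewrite eq_le mdist_ge0 andbT.
have d0 := mdist_ge0 x y.
have e : edist (0, 0) (mdist x y, 0) = mdist x y.
  by rewrite /edist/= subr0 expr0n addr0 sub0r sqrtr_sqr normrN ger0_norm.
have t01' : 0 <= 1 - t <= 1 by lra.
have [_] := cat0_triangle g1 (is_geodesic_cst y) (is_geodesic_rev g2) e
  (etrans (edistxx _) (esym (mdistxx y)))
  (etrans (edistC _ _) (etrans e (metric_sym x y))) t01 t01'.
rewrite opprB addrCA subrr addr0 => /le_trans; apply.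
rewrite /edist /eseg/= -(sqrtr0 R) ler_wsqrtr//.
by apply: eq_le_real; ring.
Qed.

Lemma oplusP x y c (t : R) :
  is_geodesic x y c -> 0 <= t <= 1 -> oplus t x y = c t.
Proof. by move=> gc; apply: geodesic_unique (geodesicP x y) gc. Qed.

End hadamard_geodesics.

Section quasilinearization.
Context {R : realType} {X : hadamardType R}.
Implicit Types x y z u v : X.

Definition quasilin x y u v : R :=
  2^-1 * (mdist x v ^+ 2 + mdist y u ^+ 2 - mdist x u ^+ 2 - mdist y v ^+ 2).

Lemma cn_ineq x y z c : is_geodesic x y c ->
  mdist z (c (2^-1)) ^+ 2 <= 2^-1 * mdist z x ^+ 2 + 2^-1 * mdist z y ^+ 2
    - 4^-1 * mdist x y ^+ 2.
Proof.
move=> gc.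
set a := mdist x y; set b := mdist z x; set k := mdist z y.
have a0 : 0 <= a by exact: mdist_ge0.
have b0 : 0 <= b by exact: mdist_ge0.
have k0 : 0 <= k by exact: mdist_ge0.
have abk : a <= b + k by rewrite /b metric_sym; exact: metric_triangle.
have bka : b <= k + a by rewrite /a metric_sym; exact: metric_triangle.
have kba : k <= b + a by exact: metric_triangle.
(* (w1, w2) is the third vertex of a comparison triangle *)
have [w1 [w2 [Eb Ek]]] : exists w1 w2 : R,
    w1 ^+ 2 + w2 ^+ 2 = b ^+ 2 /\ (w1 - a) ^+ 2 + w2 ^+ 2 = k ^+ 2.
  have [az|an] := eqVneq a 0.
    exists b, 0; rewrite az; split; first by ring.
    have -> : k = b by lra.
    by ring.
  have ap : 0 < a by rewrite lt_neqAle eq_sym an.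
  pose w1 := (b ^+ 2 + a ^+ 2 - k ^+ 2) / (2 * a).
  have w1a : 2 * a * w1 = b ^+ 2 + a ^+ 2 - k ^+ 2.
    by rewrite /w1; field.
  have Hw : 0 <= b ^+ 2 - w1 ^+ 2.
    have : 0 <= (2 * a) ^+ 2 * (b ^+ 2 - w1 ^+ 2).
      have -> : (2 * a) ^+ 2 * (b ^+ 2 - w1 ^+ 2) =
        (2 * a * b - 2 * a * w1) * (2 * a * b + 2 * a * w1) by ring.
      rewrite w1a.
      have -> : 2 * a * b - (b ^+ 2 + a ^+ 2 - k ^+ 2) =
        (k - a + b) * (k + a - b) by ring.
      have -> : 2 * a * b + (b ^+ 2 + a ^+ 2 - k ^+ 2) =
        (a + b - k) * (a + b + k) by ring.
      by rewrite !mulr_ge0//; lra.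
    by rewrite pmulr_rge0// exprn_gt0// mulr_gt0.
  exists w1, (Num.sqrt (b ^+ 2 - w1 ^+ 2)); rewrite sqr_sqrtr//; split.
    by ring.
  have -> : (w1 - a) ^+ 2 = w1 ^+ 2 - 2 * a * w1 + a ^+ 2 by ring.
  by rewrite w1a; ring.
have e1 : edist (0, 0) (a, 0) = mdist x y.
  by rewrite /edist/= subr0 expr0n addr0 sub0r sqrtr_sqr normrN ger0_norm.
have e2 : edist (a, 0) (w1, w2) = mdist y z.
  rewrite edistC /edist/= subr0 Ek sqrtr_sqr ger0_norm//.
  exact: metric_sym.
have e3 : edist (w1, w2) (0, 0) = mdist z x.
  by rewrite /edist/= !subr0 Eb sqrtr_sqr ger0_norm.
have h01 : 0 <= (2^-1 : R) <= 1 by lra.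
have z01 : 0 <= (0 : R) <= 1 by lra.
have [_] := cat0_triangle gc (geodesicP y z) (geodesicP z x) e1 e2 e3 h01 z01.
have [-> _ _] := geodesicP z x.
rewrite metric_sym => H.
have {}H : mdist z (c 2^-1) ^+ 2 <=
    edist (eseg (0, 0) (a, 0) 2^-1) (eseg (w1, w2) (0, 0) 0) ^+ 2.
  by rewrite lerXn2r// nnegrE ?mdist_ge0// /edist sqrtr_ge0.
apply: (le_trans H); rewrite /edist sqr_sqrtr; last first.
  by rewrite addr_ge0// sqr_ge0.
by rewrite /eseg/= -Eb -Ek; apply: eq_le_real; field.
Qed.

Lemma quasilin_quad x y u v :
  2 * quasilin x y u v <= mdist x y ^+ 2 + mdist u v ^+ 2.
Proof.
have gc := geodesicP x v; set m := geodesic x v (2^-1).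
have H1 := cn_ineq y gc; have H2 := cn_ineq u gc.
rewrite -/m in H1 H2.
have T : mdist y u <= mdist y m + mdist u m.
  by rewrite [mdist u m]metric_sym; exact: metric_triangle.
have T2 : mdist y u ^+ 2 <= 2 * mdist y m ^+ 2 + 2 * mdist u m ^+ 2.
  apply: (@le_trans _ _ ((mdist y m + mdist u m) ^+ 2)).
    by rewrite lerXn2r// nnegrE ?addr_ge0 ?mdist_ge0.
  have := sqr_ge0 (mdist y m - mdist u m); nra.
rewrite /quasilin.
rewrite [mdist y x]metric_sym [mdist u x]metric_sym in H1 H2.
by lra.
Qed.

Lemma quasilinDl y x z u v :
  quasilin x z u v = quasilin x y u v + quasilin y z u v.
Proof. by rewrite /quasilin; ring. Qed.

Lemma quasilinC x y u v : quasilin x y u v = quasilin u v x y.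
Proof.
rewrite /quasilin [mdist u y]metric_sym [mdist v x]metric_sym.
by rewrite [mdist u x]metric_sym [mdist v y]metric_sym; ring.
Qed.

Lemma quasilin_sym x y u v : quasilin y x u v = - quasilin x y u v.
Proof. by rewrite /quasilin; ring. Qed.

Lemma quasilin_telescope (q : nat -> X) n u v :
  quasilin (q 0%N) (q n) u v = \sum_(i < n) quasilin (q i) (q i.+1) u v.
Proof.
elim: n => [|n IH]; first by rewrite big_ord0 /quasilin; ring.
by rewrite big_ord_recr/= -IH -quasilinDl.
Qed.

Lemma geodesic_step x y (n i : nat) : (i < n)%N ->
  mdist (geodesic x y (i%:R / n%:R)) (geodesic x y (i.+1%:R / n%:R)) =
  mdist x y / n%:R.
Proof.
move=> lin; have [_ _ gd] := geodesicP x y.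
have n0 : 0 < n%:R :> R by rewrite ltr0n (leq_ltn_trans _ lin).
have H j : (j <= n)%N -> 0 <= (j%:R / n%:R : R) <= 1.
  move=> jn; rewrite divr_ge0//=.
  by rewrite ler_pdivrMr// mul1r ler_nat.
rewrite gd; [|exact/H/ltnW|exact: H].
rewrite -mulrBl -[i.+1]addn1 natrD opprD addrA subrr sub0r normrM normrN1 mul1r.
by rewrite ger0_norm ?invr_ge0 ?ltW// mulrC.
Qed.

Lemma quasilin_grid x y u v (n m : nat) : (0 < n)%N -> (0 < m)%N ->
  2 * quasilin x y u v <=
  mdist x y ^+ 2 * (m%:R / n%:R) + mdist u v ^+ 2 * (n%:R / m%:R).
Proof.
move=> n0 m0.
have n0' : n%:R != 0 :> R by rewrite pnatr_eq0 -lt0n.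
have m0' : m%:R != 0 :> R by rewrite pnatr_eq0 -lt0n.
pose q i := geodesic x y (i%:R / n%:R); pose r i := geodesic u v (i%:R / m%:R).
have [gx gy _] := geodesicP x y; have [gu gv _] := geodesicP u v.
have Ex : x = q 0%N by rewrite /q mul0r gx.
have Ey : y = q n by rewrite /q divff.
have Eu : u = r 0%N by rewrite /r mul0r gu.
have Ev : v = r m by rewrite /r divff.
have -> : quasilin x y u v = \sum_(i < n) \sum_(j < m)
    quasilin (r j) (r j.+1) (q i) (q i.+1).
  rewrite [LHS](_ : _ = quasilin (q 0%N) (q n) u v); last by rewrite -Ex -Ey.
  rewrite quasilin_telescope; apply: eq_bigr => i _.
  rewrite quasilinC [LHS](_ : _ = quasilin (r 0%N) (r m) (q i) (q i.+1)).
    exact: quasilin_telescope.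
  by rewrite -Eu -Ev.
rewrite mulr_sumr.
apply: (@le_trans _ _ (\sum_(i < n) \sum_(j < m)
    ((mdist u v / m%:R) ^+ 2 + (mdist x y / n%:R) ^+ 2))).
  apply: ler_sum => i _; rewrite mulr_sumr; apply: ler_sum => j _.
  by rewrite (le_trans (quasilin_quad _ _ _ _))// !geodesic_step.
rewrite !sumr_const !card_ord -mulrnA -[(_ + _) *+ _]mulr_natr natrM.
by apply: eq_le_real; field; rewrite n0' m0'.
Qed.

Lemma quasilin_le x y u v : quasilin x y u v <= mdist x y * mdist u v.
Proof.
have [->|xy] := eqVneq x y.
  by rewrite mdistxx mul0r; apply: eq_le_real; rewrite /quasilin; ring.
have [->|uv] := eqVneq u v.
  by rewrite mdistxx mulr0; apply: eq_le_real; rewrite /quasilin; ring.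
move: (xy) (uv); rewrite -!mdist_gt0.
set a := mdist x y; set b := mdist u v => a0 b0.
rewrite -(ler_pM2l (ltr0n R 2)).
apply/ler_addgt0Pl => e e0.
pose n := (Num.truncn (a ^+ 2 / e)).+1.
pose m := (Num.truncn (n%:R * b / a)).+1.
have n0 : 0 < n%:R :> R by rewrite ltr0n.
have m0 : 0 < m%:R :> R by rewrite ltr0n.
have nE : a ^+ 2 / e < n%:R by apply: truncnS_gt.
have mE : n%:R * b / a < m%:R by apply: truncnS_gt.
have mE' : m%:R <= n%:R * b / a + 1.
  rewrite /m -natr1 lerD2r.
  by rewrite Num.Theory.truncn_le !mulr_ge0// ?invr_ge0 ltW.
have /le_trans -> // := @quasilin_grid x y u v n m isT isT.
rewrite -/a -/b.
have E1 : a ^+ 2 * (m%:R / n%:R) <= a * b + e.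
  rewrite mulrA ler_pdivrMr//.
  apply: (@le_trans _ _ (a ^+ 2 * (n%:R * b / a + 1))).
    by rewrite ler_wpM2l// sqr_ge0.
  have -> : a ^+ 2 * (n%:R * b / a + 1) = a * b * n%:R + a ^+ 2.
    by field; rewrite gt_eqF.
  rewrite mulrDl lerD2l.
  by rewrite ltr_pdivrMr// mulrC in nE; exact: ltW.
have E2 : b ^+ 2 * (n%:R / m%:R) <= a * b.
  rewrite mulrA ler_pdivrMr//.
  rewrite ltr_pdivrMr// in mE.
  have -> : b ^+ 2 * n%:R = b * (n%:R * b) by ring.
  have -> : a * b * m%:R = b * (m%:R * a) by ring.
  by apply: ler_wpM2l; exact: ltW.
by lra.
Qed.

Lemma quasilin_CauchySchwarz x y u v :
  `|quasilin x y u v| <= mdist x y * mdist u v.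
Proof.
rewrite ler_norml quasilin_le andbT lerNl -quasilin_sym.
by rewrite [mdist x y]metric_sym quasilin_le.
Qed.

End quasilinearization.

Section dual_space.
Context {R : realType} (X : hadamardType R).

(* The class of (t, a, b), identified with its action on X^2. *)
Definition dual_class (t : R) (a b : X) : X * X -> R^o :=
  fun xy => t * quasilin a b xy.1 xy.2.

Definition dual : set (X * X -> R^o) :=
  [set f | exists t a b, f = dual_class t a b].

Definition in_ldual (f : X * X -> R^o) : Prop :=
  exists (n : nat) (alpha : 'I_n -> R) (xs : 'I_n -> X * X -> R^o),
    (forall i, dual (xs i)) /\ f = \sum_(i < n) alpha i *: xs i.

Definition ldual_pred : {pred (X * X -> R^o)} := fun f => `[< in_ldual f >].

Lemma ldual_submod_closed : submod_closed ldual_pred.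
Proof.
split.
  apply/asboolP; exists 0%N, (fun=> 0), (fun=> 0); split; first by case.
  by rewrite big_ord0.
move=> k f g /asboolP[n [a [xs [hx ->]]]] /asboolP[m [b [ys [hy ->]]]].
apply/asboolP; exists (n + m)%N,
  (fun i => match fintype.split i with inl j => k * a j | inr j => b j end),
  (fun i => match fintype.split i with inl j => xs j | inr j => ys j end).
split; first by move=> i; case: (fintype.split i).
rewrite big_split_ord/= scaler_sumr; congr (_ + _); apply: eq_bigr => i _.
  by rewrite (unsplitK (inl i)) scalerA.
by rewrite (unsplitK (inr i)).
Qed.

HB.instance Definition _ :=
  GRing.isSubmodClosed.Build R (X * X -> R^o) ldual_pred
    ldual_submod_closed.

Record ldual := LDual { ldual_fun : X * X -> R^o ; _ : ldual_fun \in ldual_pred }.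

HB.instance Definition _ := [isSub for ldual_fun].
HB.instance Definition _ := [Choice of ldual by <:].
HB.instance Definition _ := [SubChoice_isSubLmodule of ldual by <:].

Definition pairing (f : ldual) (a b : X) : R := ldual_fun f (a, b).

Lemma ldual_eqP (f g : ldual) :
  (forall a b, pairing f a b = pairing g a b) -> f = g.
Proof. by move=> fg; apply/val_inj/funext => -[a b]; exact: fg. Qed.

Lemma pairingD (f g : ldual) a b :
  pairing (f + g) a b = pairing f a b + pairing g a b.
Proof. by []. Qed.

Lemma pairingZ k (f : ldual) a b : pairing (k *: f) a b = k * pairing f a b.
Proof. by []. Qed.

Lemma pairing0 a b : pairing 0 a b = 0.
Proof. by []. Qed.

Lemma pairing_bound (f : ldual) : exists2 C : R, 0 <= C &
  forall a b, `|pairing f a b| <= C * mdist a b.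
Proof.
case: f => f /[dup] /asboolP[n [al [xs [hx E]]]] hf; rewrite /pairing/=.
have H i : exists C : R, 0 <= C /\
    forall a b : X, `|xs i (a, b)| <= C * mdist a b.
  have [t [u [v ->]]] := hx i.
  exists (`|t| * mdist u v); split; first by rewrite mulr_ge0// mdist_ge0.
  move=> a b; rewrite /dual_class/= normrM -mulrA ler_wpM2l//.
  exact: quasilin_CauchySchwarz.
have /choice[C hC] := H.
exists (\sum_(i < n) `|al i| * C i).
  by apply: sumr_ge0 => i _; rewrite mulr_ge0//; case: (hC i).
move=> a b; rewrite E fct_sumE mulr_suml.
apply: (le_trans (ler_norm_sum _ _ _)); apply: ler_sum => i _.
rewrite normrM -mulrA ler_wpM2l//.
by case: (hC i).
Qed.

Definition ldual_quotients (f : ldual) : set R :=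
  [set r | exists a b c d : X, (a, c) <> (b, d) /\
    r = `|pairing f a b - pairing f c d| / (mdist a b + mdist c d)].

(* The supremum of the empty set is 0, which is the right value when X is a
   single point. *)
Definition ldual_norm (f : ldual) : R := sup (ldual_quotients f).

Lemma mdistD_gt0 (a b c d : X) : (a, c) <> (b, d) -> 0 < mdist a b + mdist c d.
Proof.
move=> ne; rewrite lt_neqAle addr_ge0 ?mdist_ge0// andbT eq_sym.
apply: contra_notN ne.
rewrite paddr_eq0 ?mdist_ge0// => /andP[/eqP/mdist_positivity-> ].
by move=> /eqP/mdist_positivity->.
Qed.

Lemma ldual_quotients_ubound f : has_ubound (ldual_quotients f).
Proof.
have [C C0 hC] := pairing_bound f.
exists C => _ [a [b [c [d [ne ->]]]]].
rewrite ler_pdivrMr ?mdistD_gt0// mulrDr.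
by rewrite (le_trans (ler_normB _ _))// lerD.
Qed.

Lemma ldual_normP (f : ldual) a b c d :
  `|pairing f a b - pairing f c d| <= ldual_norm f * (mdist a b + mdist c d).
Proof.
have [[-> ->]|/eqP ne] := eqVneq (a, c) (b, d).
  have Z x : pairing f x x = 0.
    have [C _ hC] := pairing_bound f.
    by apply/eqP; rewrite -normr_le0 (le_trans (hC _ _))// mdistxx mulr0.
  by rewrite !Z subrr normr0 !mdistxx addr0 mulr0.
rewrite -ler_pdivrMr ?mdistD_gt0//.
by apply: (ub_le_sup (ldual_quotients_ubound f)); exists a, b, c, d.
Qed.

Lemma ldual_norm_le (f : ldual) (C : R) : 0 <= C ->
  (forall a b c d,
    `|pairing f a b - pairing f c d| <= C * (mdist a b + mdist c d)) ->
  ldual_norm f <= C.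
Proof.
move=> C0 hC; rewrite /ldual_norm.
have [->|/set0P ne] := eqVneq (ldual_quotients f) set0; first by rewrite sup0.
apply: ge_sup => // _ [a [b [c [d [abcd ->]]]]].
by rewrite ler_pdivrMr ?mdistD_gt0.
Qed.

Lemma ldual_norm_ge0 f : 0 <= ldual_norm f.
Proof.
rewrite /ldual_norm.
have [->|/set0P[r Hr]] := eqVneq (ldual_quotients f) set0.
  by rewrite sup0.
apply: le_trans (ub_le_sup (ldual_quotients_ubound f) Hr).
by case: Hr => a [b [c [d [_ ->]]]]; rewrite divr_ge0// addr_ge0 ?mdist_ge0.
Qed.

Lemma ldual_normD f g : ldual_norm (f + g) <= ldual_norm f + ldual_norm g.
Proof.
apply: ldual_norm_le; first by rewrite addr_ge0 ?ldual_norm_ge0.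
move=> a b c d; rewrite !pairingD opprD addrACA mulrDl.
by rewrite (le_trans (ler_normD _ _))// lerD// ldual_normP.
Qed.

Let ldual_normZ_le (k : R) f : ldual_norm (k *: f) <= `|k| * ldual_norm f.
Proof.
apply: ldual_norm_le; first by rewrite mulr_ge0 ?ldual_norm_ge0.
by move=> a b c d; rewrite !pairingZ -mulrBr normrM -mulrA ler_wpM2l// ldual_normP.
Qed.

Lemma ldual_normZ (k : R) f : ldual_norm (k *: f) = `|k| * ldual_norm f.
Proof.
apply/eqP; rewrite eq_le ldual_normZ_le/=.
have [->|k0] := eqVneq k 0; first by rewrite normr0 mul0r ldual_norm_ge0.
rewrite -ler_pdivlMl ?normr_gt0// -normfV.
by rewrite (le_trans _ (ldual_normZ_le _ _))// scalerA mulVf// scale1r.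
Qed.

Lemma ldual_norm_eq0 f : ldual_norm f = 0 -> f = 0.
Proof.
move=> f0; apply: ldual_eqP => a b; apply/eqP; rewrite -normr_le0.
have := ldual_normP f a b a a; rewrite f0 mul0r.
have [C _ hC] := pairing_bound f.
have -> : pairing f a a = 0.
  by apply/eqP; rewrite -normr_le0 (le_trans (hC _ _))// mdistxx mulr0.
by rewrite subr0.
Qed.

HB.instance Definition _ := Lmodule_isNormed.Build R ldual
  ldual_normD ldual_normZ ldual_norm_eq0.

Lemma ldual_normE (f : ldual) : `|f| = sup (ldual_quotients f).
Proof. by []. Qed.

End dual_space.

Section functions.
Context {R : realType} {X : hadamardType R}.
Local Notation XX := (X * ldual X)%type.
Implicit Types (h : XX -> \bar R) (p : X).
Local Open Scope ereal_scope.

Definition proper_fun h : Prop :=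
  (forall z, h z <> -oo) /\ (exists z, h z <> +oo).

Definition epigraph h : set (XX * R) := [set zr | h zr.1 <= zr.2%:E].

Definition lsc_fun h : Prop := closed (epigraph h).

(* The library sets +oo - oo = -oo; below, convexity is only used together
   with properness, which excludes the value -oo. *)
Definition convex_fun h : Prop :=
  forall (x y : X) (xd yd : ldual X) (l : R), (0 <= l <= 1)%R ->
    h (oplus l x y, ((1 - l) *: xd + l *: yd)%R) <=
    (1 - l)%:E * h (x, xd) + l%:E * h (y, yd).

Definition Gamma : set (XX -> \bar R) :=
  [set h | [/\ proper_fun h, lsc_fun h & convex_fun h]].

Definition coupling p (z : XX) : R := pairing z.2 p z.1.

Definition flip (z : XX) : ldual X * X := (z.2, z.1).

Definition indicator (T : Type) (A : set T) (z : T) : \bar R :=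
  if z \in A then 0 else +oo.

Definition le_coupling p h : set XX := [set z | h z <= (coupling p z)%:E].

Definition fenchel p h (w : ldual X * X) : \bar R :=
  ereal_sup [set (pairing w.1 p z.1 + pairing z.2 p w.2)%:E - h z | z in setT].

Definition GammaF p : set (XX -> \bar R) :=
  [set h | Gamma h /\
    h = fenchel p (h \+ indicator (le_coupling p h)) \o flip].

End functions.

(* Main.v *)
Require Import Defs.
From mathcomp Require Import all_boot all_order all_algebra.
From mathcomp Require Import all_classical all_reals all_analysis.
From mathcomp Require Import lra.

Import Order.TTheory GRing.Theory Num.Theory.
Import numFieldNormedType.Exports.

Local Open Scope classical_set_scope.
Local Open Scope ereal_scope.

(** The conjugate is a supremum, so it dominates each of its terms; moving [h z] across gives the
    Fenchel-Young inequality (i), with care only at infinite values. On the diagonal [w = flip z]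
    both pairings equal [coupling p z], which gives (ii). For (iii), [g] is itself a conjugate, and
    its own term at [z] forces the bound ([GammaF_ge_coupling]). *)

Lemma fenchel_ge (R : realType) (X : hadamardType R) (p : X)
    (h : X * ldual X -> \bar R) (w : ldual X * X) (z : X * ldual X) :
  (pairing w.1 p z.1 + pairing z.2 p w.2)%:E - h z <= fenchel p h w.
Proof. by apply: ereal_sup_ubound; exists z. Qed.

(** A point where [h] is finite contributes a finite term to the supremum. This rules out the sum
    [+oo + -oo], which is [-oo] by convention, in Fenchel-Young. *)
Lemma fenchel_gtNy (R : realType) (X : hadamardType R) (p : X)
    (h : X * ldual X -> \bar R) (w : ldual X * X) :
  proper_fun h -> fenchel p h w <> -oo.
Proof.
move=> [hNy [z hz]] E; have := @fenchel_ge _ _ p h w z; rewrite E leeNy_eq.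
by case: (h z) (hNy z) hz.
Qed.

Lemma fenchel_young (R : realType) (X : hadamardType R) (p : X)
    (h : X * ldual X -> \bar R) (z : X * ldual X) (w : ldual X * X) :
  proper_fun h ->
  (pairing w.1 p z.1 + pairing z.2 p w.2)%:E <= h z + fenchel p h w.
Proof.
move=> hproper; have [hNy _] := hproper.
case hz : (h z) => [r| |].
- by have := @fenchel_ge _ _ p h w z; rewrite hz leeBlDr// addeC.
- by rewrite addye ?leey//; apply/eqP; exact: fenchel_gtNy.
- by have := hNy z.
Qed.

(* Where [g z <= coupling p z], the indicator vanishes at [z], so testing the
   supremum at [z] itself gives [2 * coupling p z - g z <= g z]. *)
Lemma GammaF_ge_coupling (R : realType) (X : hadamardType R) (p : X)
    (g : X * ldual X -> \bar R) (z : X * ldual X) :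
  GammaF p g -> (coupling p z)%:E <= g z.
Proof.
move=> [[[gNy _] _ _] gE].
have [gz|/ltW//] := leP (g z) (coupling p z)%:E.
have := @fenchel_ge _ _ p (g \+ indicator (le_coupling p g)) (flip z) z.
rewrite -[fenchel _ _ _]/((fenchel _ _ \o flip) z) -gE /indicator mem_set//.
rewrite adde0 -/(coupling p z) /flip/=.
(* Properness excludes [-oo] and the bound by the coupling excludes [+oo], so [g z] is real. *)
case: (g z) (gNy z) gz => [r| |]// _ _.
by rewrite -EFinB !lee_fin /coupling; lra.
Qed.

Theorem proposition4p2 (R : realType) (X : hadamardType R) (p : X)
    (h : X * ldual X -> \bar R) (hproper : proper_fun h) :
  [/\ forall (x y : X) (xd yd : ldual X),
        (pairing yd p x + pairing xd p y)%:E <= h (x, xd) + fenchel p h (yd, y),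
      forall z : X * ldual X,
        (coupling p z)%:E <= (2^-1)%:E * (h z + fenchel p h (flip z)) &
      forall g : X * ldual X -> \bar R, GammaF p g ->
        forall z : X * ldual X, (coupling p z)%:E <= g z].
Proof.
split=> [x y xd yd|z|g gF z].
- exact: (fenchel_young _ _ p h (x, xd) (yd, y)).
(* Doubling the coupling matches the two equal pairings of Fenchel-Young at [flip z]. *)
- have -> : (coupling p z)%:E = (2^-1)%:E * (coupling p z + coupling p z)%:E.
    by rewrite -EFinM; congr EFin; lra.
  by apply: lee_wpmul2l; [rewrite lee_fin; lra|exact: fenchel_young].
- exact: GammaF_ge_coupling.
Qed.
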